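(* Let $\mathbb{X}$ be a semi-abelian category. The following are equivalent: (i) condition (SSH): for every morphism $p\colon E\to B$ in $\mathbb{X}$, the pullback functor $p^*\colon\mathrm{Pt}_B(\mathbb{X})\to\mathrm{Pt}_E(\mathbb{X})$ reflects Huq-commutativity of arbitrary cospans; (ii) for any weighted cospan $(x,y,w)$ in $\mathbb{X}$ such that the cospan $(x,y)$ is $w$-proper, the morphisms $x$ and $y$ commute over $w$ as soon as they Huq-commute; (iii) for any cospan $(x,y)$ in $\mathbb{X}$, the property of commuting over $w$ is independent of the chosen weight $w$ for which the cospan $(x,y)$ is $w$-proper; that is, if $w$ and $w'$ are weights such that $(x,y)$ is both $w$-proper and $w'$-proper, then $x$ and $y$ commute over $w$ if and only if they commute over $w'$; (iv) for any weighted cospan $(x,y,w)$ in $\mathbb{X}$ such that the cospan $(x,y)$ is $w$-proper, if $[\mathrm{Im}(x),\mathrm{Im}(y)]=0$ then $[\mathrm{Im}(x),\mathrm{Im}(y),\mathrm{Im}(w)]=0$.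
   Context: A semi-abelian category is a pointed, Barr exact, Bourn protomodular category with binary coproducts. For morphisms $u\colon U\to D$, $v\colon V\to D$ (and $t\colon T\to D$), $\langle u;v\rangle\colon U+V\to D$ (and $\langle u;v;t\rangle\colon U+V+T\to D$) denotes the induced morphism out of the coproduct. $\mathrm{Im}$ denotes the regular image. $\mathrm{Pt}_B(\mathbb{X})$ is the category of points over $B$: objects are triples $(A,f,r)$ with $f\colon A\to B$, $r\colon B\to A$, $f\circ r=1_B$; morphisms are compatible with the split epimorphisms and the sections. It is pointed with zero object $(B,1_B,1_B)$; $p^*$ is pullback along $p$. In a pointed category with finite products, morphisms $x\colon X\to D$ and $y\colon Y\to D$ Huq-commute if there is $\varphi\colon X\times Y\to D$ with $\varphi\circ\langle1_X,0\rangle=x$ and $\varphi\circ\langle0,1_Y\rangle=y$. A functor reflects Huq-commutativity of cospans if two morphisms with common codomain Huq-commute whenever their images under the functor do. A weighted cospan $(x,y,w)$ consists of morphisms $x\colon X\to D$, $y\colon Y\to D$, $w\colon W\to D$ with common codomain; $w$ is called the weight. The morphisms $x$ and $y$ commute over $w$ if there is a morphism $\varphi\colon (W+X)\times_W(W+Y)\to D$ such that $\varphi\circ e_1=\langle w;x\rangle$ and $\varphi\circ e_2=\langle w;y\rangle$. Here the pullback is that of $f=\langle 1_W;0\rangle\colon W+X\to W$ and $g=\langle 1_W;0\rangle\colon W+Y\to W$; writing $r\colon W\to W+X$, $s\colon W\to W+Y$ for the coproduct inclusions, $e_1=\langle 1_{W+X},s\circ f\rangle$ and $e_2=\langle r\circ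 g,1_{W+Y}\rangle$. Higgins commutators: for subobjects $k\colon K\to D$, $l\colon L\to D$, $m\colon M\to D$, let $K\diamond L$ be the kernel of the canonical morphism $K+L\to K\times L$ and let $[K,L]\leq D$ be the image of the composite $K\diamond L\to K+L\xrightarrow{\langle k;l\rangle}D$. Let $K\diamond L\diamond M$ be the kernel of the canonical morphism $K+L+M\to(K+L)\times(K+M)\times(L+M)$ (whose components send the missing summand to $0$ and are the coproduct inclusions on the other two) and let $[K,L,M]\leq D$ be the image of the composite $K\diamond L\diamond M\to K+L+M\xrightarrow{\langle k;l;m\rangle}D$. Given a morphism $w\colon W\to D$, a subobject $X\leq D$ is $w$-normal if $[\mathrm{Im}(w),X]\leq X$. Given a weighted cospan $(x,y,w)$, the cospan $(x,y)$ is $w$-proper if $\mathrm{Im}(x)$ and $\mathrm{Im}(y)$ are $w$-normal, i.e., $[\mathrm{Im}(w),\mathrm{Im}(x)]\leq\mathrm{Im}(x)$ and $[\mathrm{Im}(w),\mathrm{Im}(y)]\leq\mathrm{Im}(y)$. *)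

(* Defs.v *)
From mathcomp Require Import ssreflect ssrfun ssrbool.
From Stdlib Require Import ProofIrrelevance.

Set Implicit Arguments.
Unset Strict Implicit.
Unset Printing Implicit Defensive.

Declare Scope cat_scope.
Delimit Scope cat_scope with cat.
Local Open Scope cat_scope.

Reserved Notation "a ~> b" (at level 99, b at level 200).
Reserved Notation "g ∘ f" (at level 40, left associativity).

Record category := Category {
  obj :> Type;
  hom : obj -> obj -> Type;
  idm : forall a, hom a a;
  comp : forall a b c, hom b c -> hom a b -> hom a c;
  comp1m : forall a b (f : hom a b), comp (idm b) f = f;
  compm1 : forall a b (f : hom a b), comp f (idm a) = f;
  compA : forall a b c d (h : hom c d) (g : hom b c) (f : hom a b),
    comp h (comp g f) = comp (comp h g) f
}.

Arguments hom {_} a b.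
Arguments idm {_} a.
Arguments comp {_ _ _ _} _ _.
Notation "a ~> b" := (hom a b) : cat_scope.
Notation "g ∘ f" := (comp g f) : cat_scope.

Record functor (C D : category) := Functor {
  fobj :> C -> D;
  fmap : forall a b : C, (a ~> b) -> (fobj a ~> fobj b);
  fmap1 : forall a : C, fmap (idm a) = idm (fobj a);
  fmapM : forall (a b c : C) (g : b ~> c) (f : a ~> b),
    fmap (g ∘ f) = fmap g ∘ fmap f
}.

Arguments fmap {C D} _ {a b} _.

Definition is_mono {C : category} {a b : C} (m : a ~> b) : Prop :=
  forall (c : C) (u v : c ~> a), m ∘ u = m ∘ v -> u = v.

Definition is_iso {C : category} {a b : C} (f : a ~> b) : Prop :=
  exists g : b ~> a, g ∘ f = idm a /\ f ∘ g = idm b.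

Definition reflects_iso {C D : category} (F : functor C D) : Prop :=
  forall (a b : C) (f : a ~> b), is_iso (fmap F f) -> is_iso f.

Definition is_coequalizer {C : category} {a b c : C}
    (u v : a ~> b) (q : b ~> c) : Prop :=
  q ∘ u = q ∘ v /\
  forall (d : C) (h : b ~> d), h ∘ u = h ∘ v -> exists! k : c ~> d, k ∘ q = h.

Definition is_regular_epi {C : category} {b c : C} (q : b ~> c) : Prop :=
  exists (a : C) (u v : a ~> b), is_coequalizer u v q.

Definition is_pullback {C : category} {a b c p : C}
    (f : a ~> c) (g : b ~> c) (p1 : p ~> a) (p2 : p ~> b) : Prop :=
  f ∘ p1 = g ∘ p2 /\
  forall (t : C) (u : t ~> a) (v : t ~> b), f ∘ u = g ∘ v ->
    exists! k : t ~> p, p1 ∘ k = u /\ p2 ∘ k = v.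

(* Limits and colimits are given by a choice of universal objects. *)

Class has_zero (C : category) := HasZero {
  zero_obj : C;
  from_zero : forall a : C, zero_obj ~> a;
  to_zero : forall a : C, a ~> zero_obj;
  from_zero_uniq : forall (a : C) (u v : zero_obj ~> a), u = v;
  to_zero_uniq : forall (a : C) (u v : a ~> zero_obj), u = v
}.

Definition zero_mor {C : category} {Z : has_zero C} (a b : C) : a ~> b :=
  from_zero b ∘ to_zero a.

Class has_products (C : category) := HasProducts {
  bprod : C -> C -> C;
  pr1 : forall a b : C, bprod a b ~> a;
  pr2 : forall a b : C, bprod a b ~> b;
  bpair : forall a b t : C, (t ~> a) -> (t ~> b) -> (t ~> bprod a b);
  pr1_bpair : forall (a b t : C) (u : t ~> a) (v : t ~> b),
    pr1 a b ∘ bpair u v = u;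
  pr2_bpair : forall (a b t : C) (u : t ~> a) (v : t ~> b),
    pr2 a b ∘ bpair u v = v;
  bprod_uniq : forall (a b t : C) (h k : t ~> bprod a b),
    pr1 a b ∘ h = pr1 a b ∘ k -> pr2 a b ∘ h = pr2 a b ∘ k -> h = k
}.

Class has_coproducts (C : category) := HasCoproducts {
  bcoprod : C -> C -> C;
  in1 : forall a b : C, a ~> bcoprod a b;
  in2 : forall a b : C, b ~> bcoprod a b;
  copair : forall a b t : C, (a ~> t) -> (b ~> t) -> (bcoprod a b ~> t);
  copair_in1 : forall (a b t : C) (u : a ~> t) (v : b ~> t),
    copair u v ∘ in1 a b = u;
  copair_in2 : forall (a b t : C) (u : a ~> t) (v : b ~> t),
    copair u v ∘ in2 a b = v;
  bcoprod_uniq : forall (a b t : C) (h k : bcoprod a b ~> t),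
    h ∘ in1 a b = k ∘ in1 a b -> h ∘ in2 a b = k ∘ in2 a b -> h = k
}.

Class has_pullbacks (C : category) := HasPullbacks {
  pb : forall a b c : C, (a ~> c) -> (b ~> c) -> C;
  pb1 : forall (a b c : C) (f : a ~> c) (g : b ~> c), pb f g ~> a;
  pb2 : forall (a b c : C) (f : a ~> c) (g : b ~> c), pb f g ~> b;
  pb_comm : forall (a b c : C) (f : a ~> c) (g : b ~> c),
    f ∘ pb1 f g = g ∘ pb2 f g;
  pb_pair : forall (a b c : C) (f : a ~> c) (g : b ~> c)
    (t : C) (u : t ~> a) (v : t ~> b), f ∘ u = g ∘ v -> (t ~> pb f g);
  pb1_pair : forall (a b c : C) (f : a ~> c) (g : b ~> c)
    (t : C) (u : t ~> a) (v : t ~> b) (e : f ∘ u = g ∘ v),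
    pb1 f g ∘ pb_pair e = u;
  pb2_pair : forall (a b c : C) (f : a ~> c) (g : b ~> c)
    (t : C) (u : t ~> a) (v : t ~> b) (e : f ∘ u = g ∘ v),
    pb2 f g ∘ pb_pair e = v;
  pb_uniq : forall (a b c : C) (f : a ~> c) (g : b ~> c)
    (t : C) (h k : t ~> pb f g),
    pb1 f g ∘ h = pb1 f g ∘ k -> pb2 f g ∘ h = pb2 f g ∘ k -> h = k
}.

Class has_kernel_pair_coequalizers (C : category) {P : has_pullbacks C} :=
  HasKernelPairCoequalizers {
  coim : forall a b : C, (a ~> b) -> C;
  coim_map : forall (a b : C) (f : a ~> b), a ~> coim f;
  coim_comm : forall (a b : C) (f : a ~> b),
    coim_map f ∘ pb1 f f = coim_map f ∘ pb2 f f;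
  coim_desc : forall (a b : C) (f : a ~> b) (t : C) (h : a ~> t),
    h ∘ pb1 f f = h ∘ pb2 f f -> (coim f ~> t);
  coim_descE : forall (a b : C) (f : a ~> b) (t : C) (h : a ~> t)
    (e : h ∘ pb1 f f = h ∘ pb2 f f), coim_desc e ∘ coim_map f = h;
  coim_uniq : forall (a b : C) (f : a ~> b) (t : C) (h k : coim f ~> t),
    h ∘ coim_map f = k ∘ coim_map f -> h = k
}.

Arguments has_kernel_pair_coequalizers C {P}.

Definition regular_epi_stable (C : category) {P : has_pullbacks C} : Prop :=
  forall (a b c : C) (f : a ~> c) (g : b ~> c),
    is_regular_epi f -> is_regular_epi (pb2 f g).

Arguments regular_epi_stable C {P}.

Definition is_equivalence_relation {C : category} {P : has_pullbacks C}
    {r a : C} (d1 d2 : r ~> a) : Prop :=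
  [/\ forall (t : C) (u v : t ~> r),
        d1 ∘ u = d1 ∘ v -> d2 ∘ u = d2 ∘ v -> u = v,
      exists i : a ~> r, d1 ∘ i = idm a /\ d2 ∘ i = idm a,
      exists s : r ~> r, d1 ∘ s = d2 /\ d2 ∘ s = d1 &
      exists m : pb d2 d1 ~> r,
        d1 ∘ m = d1 ∘ pb1 d2 d1 /\ d2 ∘ m = d2 ∘ pb2 d2 d1].

Definition equivalence_relations_effective (C : category)
    {P : has_pullbacks C} : Prop :=
  forall (r a : C) (d1 d2 : r ~> a), is_equivalence_relation d1 d2 ->
    exists (q : C) (f : a ~> q), is_pullback f f d1 d2.

Arguments equivalence_relations_effective C {P}.

Record point (C : category) (B : C) := Point {
  pt_obj :> C;
  pt_epi : pt_obj ~> B;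
  pt_sec : B ~> pt_obj;
  pt_epi_sec : pt_epi ∘ pt_sec = idm B
}.

Arguments pt_epi {C B} _.
Arguments pt_sec {C B} _.
Arguments pt_epi_sec {C B} _.

Record point_hom (C : category) (B : C) (A A' : point B) := PointHom {
  pt_map :> (A : C) ~> A';
  pt_map_epi : pt_epi A' ∘ pt_map = pt_epi A;
  pt_map_sec : pt_map ∘ pt_sec A = pt_sec A'
}.

Lemma point_hom_eq (C : category) (B : C) (A A' : point B)
  (f g : point_hom A A') : pt_map f = pt_map g -> f = g.
Proof.
case: f g => [f e s] [g e' s'] /= efg; case: _ / efg e' s' => e' s'.
by rewrite (proof_irrelevance _ e e') (proof_irrelevance _ s s').
Qed.

Section Points.
Context {C : category}.
Implicit Types B E : C.

Definition point_id B (A : point B) : point_hom A A :=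
  PointHom (compm1 (pt_epi A)) (comp1m (pt_sec A)).

Lemma point_comp_epi B (A1 A2 A3 : point B)
    (g : point_hom A2 A3) (f : point_hom A1 A2) :
  pt_epi A3 ∘ (pt_map g ∘ pt_map f) = pt_epi A1.
Proof. by rewrite compA !pt_map_epi. Qed.

Lemma point_comp_sec B (A1 A2 A3 : point B)
    (g : point_hom A2 A3) (f : point_hom A1 A2) :
  pt_map g ∘ pt_map f ∘ pt_sec A1 = pt_sec A3.
Proof. by rewrite -compA !pt_map_sec. Qed.

Definition point_comp B (A1 A2 A3 : point B)
    (g : point_hom A2 A3) (f : point_hom A1 A2) : point_hom A1 A3 :=
  PointHom (point_comp_epi g f) (point_comp_sec g f).

Definition Pt B : category.
Proof.
apply: (@Category (point B) (@point_hom C B) (@point_id B) (@point_comp B)).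
- by move=> *; apply: point_hom_eq; exact: comp1m.
- by move=> *; apply: point_hom_eq; exact: compm1.
- by move=> *; apply: point_hom_eq; exact: compA.
Defined.

Definition pt_zero B : point B := Point (comp1m (idm B)).

Definition pt_from_zero B (A : point B) : point_hom (pt_zero B) A :=
  @PointHom C B (pt_zero B) A (pt_sec A) (pt_epi_sec A) (compm1 (pt_sec A)).

Definition pt_to_zero B (A : point B) : point_hom A (pt_zero B) :=
  @PointHom C B A (pt_zero B) (pt_epi A) (comp1m (pt_epi A)) (pt_epi_sec A).

#[global] Instance Pt_has_zero B : has_zero (Pt B).
Proof.
apply: (@HasZero (Pt B) (pt_zero B) (@pt_from_zero B) (@pt_to_zero B)).
- move=> A u v; apply: point_hom_eq.
  by move: (pt_map_sec u) (pt_map_sec v); rewrite /= !compm1 => -> ->.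
- move=> A u v; apply: point_hom_eq.
  by move: (pt_map_epi u) (pt_map_epi v); rewrite /= !comp1m => -> ->.
Defined.

Context {P : has_pullbacks C}.

Lemma pt_prod_sec_comm B (A A' : point B) :
  pt_epi A ∘ pt_sec A = pt_epi A' ∘ pt_sec A'.
Proof. by rewrite !pt_epi_sec. Qed.

Lemma pt_prod_epi_sec B (A A' : point B) :
  pt_epi A ∘ pb1 (pt_epi A) (pt_epi A') ∘ pb_pair (pt_prod_sec_comm A A')
  = idm B.
Proof. by rewrite -compA pb1_pair pt_epi_sec. Qed.

Definition pt_prod B (A A' : point B) : point B := Point (pt_prod_epi_sec A A').

Lemma pt_pr2_epi B (A A' : point B) :
  pt_epi A' ∘ pb2 (pt_epi A) (pt_epi A') = pt_epi (pt_prod A A').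
Proof. by rewrite -pb_comm. Qed.

Definition pt_pr1 B (A A' : point B) : point_hom (pt_prod A A') A :=
  @PointHom C B (pt_prod A A') A (pb1 (pt_epi A) (pt_epi A'))
    erefl (pb1_pair (pt_prod_sec_comm A A')).

Definition pt_pr2 B (A A' : point B) : point_hom (pt_prod A A') A' :=
  @PointHom C B (pt_prod A A') A' (pb2 (pt_epi A) (pt_epi A'))
    (pt_pr2_epi A A') (pb2_pair (pt_prod_sec_comm A A')).

Lemma pt_pair_comm B (A A' T : point B)
    (u : point_hom T A) (v : point_hom T A') :
  pt_epi A ∘ pt_map u = pt_epi A' ∘ pt_map v.
Proof. by rewrite !pt_map_epi. Qed.

Lemma pt_pair_epi B (A A' T : point B)
    (u : point_hom T A) (v : point_hom T A') :
  pt_epi (pt_prod A A') ∘ pb_pair (pt_pair_comm u v) = pt_epi T.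
Proof. by rewrite /= -compA pb1_pair pt_map_epi. Qed.

Lemma pt_pair_sec B (A A' T : point B)
    (u : point_hom T A) (v : point_hom T A') :
  pb_pair (pt_pair_comm u v) ∘ pt_sec T = pt_sec (pt_prod A A').
Proof.
by apply: pb_uniq; rewrite compA /= ?pb1_pair ?pb2_pair pt_map_sec.
Qed.

Definition pt_pair B (A A' T : point B)
    (u : point_hom T A) (v : point_hom T A') : point_hom T (pt_prod A A') :=
  PointHom (pt_pair_epi u v) (pt_pair_sec u v).

#[global] Instance Pt_has_products B : has_products (Pt B).
Proof.
apply: (@HasProducts (Pt B) (@pt_prod B) (@pt_pr1 B) (@pt_pr2 B) (@pt_pair B)).
- by move=> *; apply: point_hom_eq; exact: pb1_pair.
- by move=> *; apply: point_hom_eq; exact: pb2_pair.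
- move=> A A' T h k e1 e2; apply: point_hom_eq; apply: pb_uniq.
  + exact: (f_equal (fun z => pt_map z) e1).
  + exact: (f_equal (fun z => pt_map z) e2).
Defined.

Lemma pt_pullback_sec_comm E B (p : E ~> B) (A : point B) :
  pt_epi A ∘ (pt_sec A ∘ p) = p ∘ idm E.
Proof. by rewrite compA pt_epi_sec comp1m compm1. Qed.

Definition pt_pullback E B (p : E ~> B) (A : point B) : point E :=
  Point (pb2_pair (pt_pullback_sec_comm p A)).

Lemma pt_pullback_map_comm E B (p : E ~> B) (A A' : point B)
    (f : point_hom A A') :
  pt_epi A' ∘ (pt_map f ∘ pb1 (pt_epi A) p) = p ∘ pb2 (pt_epi A) p.
Proof. by rewrite compA pt_map_epi pb_comm. Qed.

Lemma pt_pullback_map_sec E B (p : E ~> B) (A A' : point B)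
    (f : point_hom A A') :
  pb_pair (pt_pullback_map_comm p f) ∘ pt_sec (pt_pullback p A)
  = pt_sec (pt_pullback p A').
Proof.
apply: pb_uniq; rewrite compA ?pb1_pair ?pb2_pair /= ?pb2_pair //.
by rewrite -compA pb1_pair compA pt_map_sec.
Qed.

Definition pt_pullback_map E B (p : E ~> B) (A A' : point B)
    (f : point_hom A A') : point_hom (pt_pullback p A) (pt_pullback p A') :=
  @PointHom C E (pt_pullback p A) (pt_pullback p A')
    (pb_pair (pt_pullback_map_comm p f))
    (pb2_pair (pt_pullback_map_comm p f)) (pt_pullback_map_sec p f).

Definition pullback_functor E B (p : E ~> B) : functor (Pt B) (Pt E).
Proof.
apply: (@Functor (Pt B) (Pt E) (pt_pullback p) (@pt_pullback_map E B p)).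
- move=> A; apply: point_hom_eq; apply: pb_uniq => /=;
  by rewrite ?pb1_pair ?pb2_pair ?compm1 ?comp1m.
- move=> A1 A2 A3 g f; apply: point_hom_eq; apply: pb_uniq => /=.
  + by rewrite compA !pb1_pair -!compA pb1_pair.
  + by rewrite compA !pb2_pair.
Defined.

End Points.

Record semi_abelian := SemiAbelian {
  sa_cat :> category;
  sa_zero : has_zero sa_cat;
  sa_products : has_products sa_cat;
  sa_pullbacks : has_pullbacks sa_cat;
  sa_coproducts : has_coproducts sa_cat;
  sa_coequalizers : has_kernel_pair_coequalizers sa_cat;
  sa_regular : regular_epi_stable sa_cat;
  sa_exact : equivalence_relations_effective sa_cat;
  sa_protomodular : forall (E B : sa_cat) (p : E ~> B),
    reflects_iso (pullback_functor p)
}.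

#[global] Existing Instances
  sa_zero sa_products sa_pullbacks sa_coproducts sa_coequalizers.

Definition huq_commute {C : category} {Z : has_zero C} {P : has_products C}
    {X Y D : C} (x : X ~> D) (y : Y ~> D) : Prop :=
  exists phi : bprod X Y ~> D,
    phi ∘ bpair (idm X) (zero_mor X Y) = x /\
    phi ∘ bpair (zero_mor Y X) (idm Y) = y.

Definition reflects_huq_commute {C C' : category}
    {Z : has_zero C} {P : has_products C}
    {Z' : has_zero C'} {P' : has_products C'} (F : functor C C') : Prop :=
  forall (X Y D : C) (x : X ~> D) (y : Y ~> D),
    huq_commute (fmap F x) (fmap F y) -> huq_commute x y.

Record subobject (C : category) (D : C) := Subobject {
  sub_obj : C;
  sub_map : sub_obj ~> D;
  sub_mono : is_mono sub_map
}.

Arguments sub_map {C D} _.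

Definition sub_le {C : category} {D : C} (k l : subobject D) : Prop :=
  exists h : sub_obj k ~> sub_obj l, sub_map l ∘ h = sub_map k.

Lemma regular_epi_epi {C : category} {a b : C} (q : a ~> b) :
  is_regular_epi q -> forall (c : C) (u v : b ~> c), u ∘ q = v ∘ q -> u = v.
Proof.
case=> [z [f [g [e U]]]] c u v euv.
have [|k [_ K]] := U c (u ∘ q); first by rewrite -!compA e.
by rewrite -(K u) // (K v).
Qed.

Lemma coim_map_regular_epi {C : category} {P : has_pullbacks C}
    {Q : has_kernel_pair_coequalizers C} {a b : C} (f : a ~> b) :
  is_regular_epi (coim_map f).
Proof.
exists (pb f f), (pb1 f f), (pb2 f f); split; first exact: coim_comm.
move=> d h e; exists (coim_desc e); split; first exact: coim_descE.
by move=> k ek; apply: coim_uniq; rewrite coim_descE ek.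
Qed.

Definition im_map {C : category} {P : has_pullbacks C}
    {Q : has_kernel_pair_coequalizers C} {a b : C} (f : a ~> b) : coim f ~> b :=
  coim_desc (pb_comm f f).

Lemma im_map_mono (X : semi_abelian) (a b : X) (f : a ~> b) :
  is_mono (im_map f).
Proof.
move=> t u v euv; have re : is_regular_epi (coim_map f) by exact: coim_map_regular_epi.
set e := coim_map f in re.
have ep := regular_epi_epi (sa_regular u re).
set p := pb2 e u in ep.
have eq := regular_epi_epi (sa_regular (v ∘ p) re).
set q := pb2 e (v ∘ p) in eq.
have E1 : e ∘ (pb1 e u ∘ q) = u ∘ p ∘ q by rewrite compA pb_comm.
have E2 : e ∘ pb1 e (v ∘ p) = v ∘ p ∘ q by rewrite pb_comm.
have F : f ∘ (pb1 e u ∘ q) = f ∘ pb1 e (v ∘ p).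
  have fE : im_map f ∘ e = f by exact: coim_descE.
  have fE' c (h : c ~> a) : f ∘ h = im_map f ∘ (e ∘ h) by rewrite compA fE.
  by rewrite !fE' E1 E2 !compA euv.
apply: ep; apply: eq; rewrite -E1 -E2.
by rewrite -(pb1_pair F) -[in RHS](pb2_pair F) !compA coim_comm.
Qed.

(* The regular image of f: its factorization through the coequalizer of its
   kernel pair. *)
Definition Im {X : semi_abelian} {a b : X} (f : a ~> b) : subobject b :=
  Subobject (@im_map_mono X a b f).

Lemma from_zero_mono (C : category) {Z : has_zero C} (a : C) :
  is_mono (from_zero a).
Proof. by move=> c u v _; exact: to_zero_uniq. Qed.

Definition sub_zero {C : category} {Z : has_zero C} (D : C) : subobject D :=
  Subobject (@from_zero_mono C Z D).

Definition sub_eq {C : category} {D : C} (k l : subobject D) : Prop :=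
  sub_le k l /\ sub_le l k.

Definition kernel {C : category} {Z : has_zero C} {P : has_pullbacks C}
    {a b : C} (f : a ~> b) : pb f (from_zero b) ~> a :=
  pb1 f (from_zero b).

Definition coprod_to_prod {X : semi_abelian} (K L : X) :
    bcoprod K L ~> bprod K L :=
  bpair (copair (idm K) (zero_mor L K)) (copair (zero_mor K L) (idm L)).

Definition higgins2 {X : semi_abelian} {D : X} (k l : subobject D) :
    subobject D :=
  Im (copair (sub_map k) (sub_map l) ∘ kernel (coprod_to_prod _ _)).

Definition copair3 {C : category} {S : has_coproducts C} {K L M D : C}
    (k : K ~> D) (l : L ~> D) (m : M ~> D) : bcoprod (bcoprod K L) M ~> D :=
  copair (copair k l) m.

Definition coprod3_to_prod3 {X : semi_abelian} (K L M : X) :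
    bcoprod (bcoprod K L) M ~>
    bprod (bprod (bcoprod K L) (bcoprod K M)) (bcoprod L M) :=
  bpair (bpair (copair3 (in1 K L) (in2 K L) (zero_mor M _))
               (copair3 (in1 K M) (zero_mor L _) (in2 K M)))
        (copair3 (zero_mor K _) (in1 L M) (in2 L M)).

Definition higgins3 {X : semi_abelian} {D : X} (k l m : subobject D) :
    subobject D :=
  Im (copair3 (sub_map k) (sub_map l) (sub_map m)
        ∘ kernel (coprod3_to_prod3 _ _ _)).

Definition w_normal {X : semi_abelian} {W D : X} (w : W ~> D)
    (k : subobject D) : Prop :=
  sub_le (higgins2 (Im w) k) k.

Definition w_proper {X : semi_abelian} {U V W D : X}
    (x : U ~> D) (y : V ~> D) (w : W ~> D) : Prop :=
  w_normal w (Im x) /\ w_normal w (Im y).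

Definition coprod_point {C : category} {Z : has_zero C} {S : has_coproducts C}
    (W A : C) : point W :=
  @Point C W (bcoprod W A) (copair (idm W) (zero_mor A W)) (in1 W A)
    (copair_in1 _ _).

(* For points A = (A, f, r) and A' = (A', g, s) over B, pt_incl1 and pt_incl2
   are <1, s ∘ f> and <r ∘ g, 1> into the pullback of f along g. *)
Lemma pt_incl1_comm {C : category} {B : C} (A A' : point B) :
  pt_epi A ∘ idm (A : C) = pt_epi A' ∘ (pt_sec A' ∘ pt_epi A).
Proof. by rewrite compA pt_epi_sec comp1m compm1. Qed.

Definition pt_incl1 {C : category} {P : has_pullbacks C} {B : C}
    (A A' : point B) : (A : C) ~> pb (pt_epi A) (pt_epi A') :=
  pb_pair (pt_incl1_comm A A').

Lemma pt_incl2_comm {C : category} {B : C} (A A' : point B) :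
  pt_epi A ∘ (pt_sec A ∘ pt_epi A') = pt_epi A' ∘ idm (A' : C).
Proof. by rewrite compA pt_epi_sec comp1m compm1. Qed.

Definition pt_incl2 {C : category} {P : has_pullbacks C} {B : C}
    (A A' : point B) : (A' : C) ~> pb (pt_epi A) (pt_epi A') :=
  pb_pair (pt_incl2_comm A A').

Definition commute_over {X : semi_abelian} {U V W D : X}
    (x : U ~> D) (y : V ~> D) (w : W ~> D) : Prop :=
  exists phi : pb (pt_epi (coprod_point W U)) (pt_epi (coprod_point W V)) ~> D,
    phi ∘ pt_incl1 (coprod_point W U) (coprod_point W V) = copair w x /\
    phi ∘ pt_incl2 (coprod_point W U) (coprod_point W V) = copair w y.

Definition SSH (X : semi_abelian) : Prop :=
  forall (E B : X) (p : E ~> B), reflects_huq_commute (pullback_functor p).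

(* Main.v *)
From Stdlib Require Import Setoid.
From mathcomp Require Import ssreflect ssrfun ssrbool seq.
Require Import Defs.

Set Implicit Arguments.
Unset Strict Implicit.
Unset Printing Implicit Defensive.

Local Open Scope cat_scope.

(** All four conditions are compared through one notion: for points A and A'
    over B, two morphisms u : A -> D and v : A' -> D commute on the fibre
    product when they extend along the two canonical inclusions of A and A'
    into the pullback of A and A' over B ([commute_on]).  Over the zero object
    this is Huq-commutativity; for the points W + X and W + Y over W it is
    commutation over the weight w; for morphisms of points it is
    Huq-commutativity in the category of points.

    Protomodularity enters through [split_jointly_strong]: the kernel and the
    section of a split epimorphism are jointly strongly epic.  Therefore the
    two inclusions into a fibre product are jointly epic, strong epimorphisms
    are cokernels of their kernels, and the relation [commute_on] both
    restricts along morphisms of points and descends along strongly epic ones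
    ([commute_on_comp], [commute_on_desc]).  In particular everything depends
    on x, y and w only through their images.

    (SSH) is equivalent to (ii).  By pulling back to the zero object, (SSH)
    says that morphisms of points x and y commute over B as soon as their
    restrictions to the kernels Huq-commute ([SSH_kernels]).  Given a proper
    weighted cospan, the kernel of W + X -> W is generated by X and by the
    diamond of W and X, so properness keeps its image under <w; x> inside
    Im(x) ([factors_conjugation]); hence Huq-commutativity of x
    and y gives that of the kernels of the morphisms from W + X and W + Y to
    the point D x W.  Conversely, the restrictions to the kernels of morphisms
    of points with codomain D form a cospan that is proper for the section
    B -> D ([w_normal_kernel]), and B + Ker -> A is a strong epimorphism along
    which commutation over B descends.

    (ii) is equivalent to (iii) because commutation over any weight implies
    Huq-commutativity, which is commutation over the zero weight, and every
    cospan is proper for the zero weight.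

    (ii) is equivalent to (iv) because X + Y + W maps strongly onto
    (W + X) x_W (W + Y), and the kernel of this map is a split extension of
    the binary diamond of X and Y by the ternary diamond of X, Y and W.  So
    <x; y; w> factors through the fibre product if and only if it kills both
    diamonds ([commute_over_diamond]). *)

(** * Equational calculus *)

Section Calculus.
Context {C : category}.
Implicit Types a b c d t : C.

(** The rules below whose names end in A are the forms that apply inside a
    composite associated to the right. *)
Lemma pr1_bpairA {P : has_products C} a b c t (u : c ~> a) (v : c ~> b)
    (h : t ~> c) : pr1 a b ∘ (bpair u v ∘ h) = u ∘ h.
Proof. by rewrite compA pr1_bpair. Qed.

Lemma pr2_bpairA {P : has_products C} a b c t (u : c ~> a) (v : c ~> b)
    (h : t ~> c) : pr2 a b ∘ (bpair u v ∘ h) = v ∘ h.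
Proof. by rewrite compA pr2_bpair. Qed.

Lemma copair_in1A {S : has_coproducts C} a b c t (u : a ~> c) (v : b ~> c)
    (h : t ~> a) : copair u v ∘ (in1 a b ∘ h) = u ∘ h.
Proof. by rewrite compA copair_in1. Qed.

Lemma copair_in2A {S : has_coproducts C} a b c t (u : a ~> c) (v : b ~> c)
    (h : t ~> b) : copair u v ∘ (in2 a b ∘ h) = v ∘ h.
Proof. by rewrite compA copair_in2. Qed.

Lemma pb1_pairA {P : has_pullbacks C} a b c d t (f : a ~> c) (g : b ~> c)
    (u : d ~> a) (v : d ~> b) (e : f ∘ u = g ∘ v) (h : t ~> d) :
  pb1 f g ∘ (pb_pair e ∘ h) = u ∘ h.
Proof. by rewrite compA pb1_pair. Qed.

Lemma pb2_pairA {P : has_pullbacks C} a b c d t (f : a ~> c) (g : b ~> c)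
    (u : d ~> a) (v : d ~> b) (e : f ∘ u = g ∘ v) (h : t ~> d) :
  pb2 f g ∘ (pb_pair e ∘ h) = v ∘ h.
Proof. by rewrite compA pb2_pair. Qed.

Lemma epi_secA B (A : point B) t (h : t ~> B) :
  pt_epi A ∘ (pt_sec A ∘ h) = h.
Proof. by rewrite compA pt_epi_sec comp1m. Qed.

Lemma comp_copair {S : has_coproducts C} a b c d (h : c ~> d) (u : a ~> c)
    (v : b ~> c) : h ∘ copair u v = copair (h ∘ u) (h ∘ v).
Proof. by apply: bcoprod_uniq; rewrite -compA ?copair_in1 ?copair_in2. Qed.

Lemma comp0m {Z : has_zero C} a b c (f : a ~> b) :
  zero_mor b c ∘ f = zero_mor a c.
Proof.
by rewrite /zero_mor -compA (to_zero_uniq (to_zero b ∘ f) (to_zero a)).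
Qed.

Lemma compm0 {Z : has_zero C} a b c (f : b ~> c) :
  f ∘ zero_mor a b = zero_mor a c.
Proof.
by rewrite /zero_mor compA (from_zero_uniq (f ∘ from_zero b) (from_zero c)).
Qed.

Lemma from_zero_comp {Z : has_zero C} a b (f : a ~> zero_obj) :
  from_zero b ∘ f = zero_mor a b.
Proof. by rewrite /zero_mor (to_zero_uniq f (to_zero a)). Qed.

Lemma comp_kernel {Z : has_zero C} {P : has_pullbacks C} a b (f : a ~> b) :
  f ∘ kernel f = zero_mor _ b.
Proof. by rewrite /kernel pb_comm from_zero_comp. Qed.

Lemma comp_kernelA {Z : has_zero C} {P : has_pullbacks C} a b t (f : a ~> b)
    (h : t ~> _) : f ∘ (kernel f ∘ h) = zero_mor t b.
Proof. by rewrite compA comp_kernel comp0m. Qed.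

Lemma kernel_mono {Z : has_zero C} {P : has_pullbacks C} a b (f : a ~> b) :
  is_mono (kernel f).
Proof. by move=> t u v e; exact: pb_uniq e (to_zero_uniq _ _). Qed.

End Calculus.

Definition catE := (@comp1m, @compm1, @comp0m, @compm0, @pr1_bpair, @pr2_bpair,
  @pr1_bpairA, @pr2_bpairA, @copair_in1, @copair_in2, @copair_in1A,
  @copair_in2A, @pb1_pair, @pb2_pair, @pb1_pairA, @pb2_pairA, @pt_epi_sec,
  @epi_secA, @comp_kernel, @comp_kernelA).

Ltac cat_simpl := do ?[progress rewrite -?compA ?catE /=].

(** * Strong epimorphisms and protomodularity *)

Definition factors {C : category} {a b c : C} (m : b ~> c) (v : a ~> c) : Prop :=
  exists t : a ~> b, m ∘ t = v.

Lemma factors_comp {C : category} {a b c d : C} (m : b ~> c) (v : a ~> c)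
  (h : d ~> a) : factors m v -> factors m (v ∘ h).
Proof. by case=> t <-; exists (t ∘ h); rewrite compA. Qed.

Lemma factors_trans {C : category} {a b c d : C} (m : b ~> c) (n : d ~> c)
  (v : a ~> c) : factors m n -> factors n v -> factors m v.
Proof. by move=> mn [t <-]; exact: factors_comp. Qed.

Lemma factors_kernel {C : category} {Z : has_zero C} {P : has_pullbacks C}
    {a b t : C} (f : a ~> b) (h : t ~> a) :
  f ∘ h = zero_mor t b -> factors (kernel f) h.
Proof.
move=> e; have e' : f ∘ h = from_zero b ∘ to_zero t by [].
by exists (pb_pair e'); rewrite /kernel pb1_pair.
Qed.

(** Testing against v, and not only against the identity of b, builds the
    diagonal fill-in property into the definition; it is equivalent to
    extremality as soon as monomorphisms can be pulled back. *)
Definition strong_epi {C : category} {a b : C} (q : a ~> b) : Prop :=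
  forall (M D : C) (m : M ~> D) (v : b ~> D),
    is_mono m -> factors m (v ∘ q) -> factors m v.

Definition jointly_strong {C : category} {a a' b : C} (f : a ~> b)
    (g : a' ~> b) : Prop :=
  forall (M D : C) (m : M ~> D) (v : b ~> D),
    is_mono m -> factors m (v ∘ f) -> factors m (v ∘ g) -> factors m v.

Section SemiAbelian.
Context {X : semi_abelian}.

Lemma pb2_mono (a b c : X) (m : a ~> c) (v : b ~> c) :
  is_mono m -> is_mono (pb2 m v).
Proof.
move=> mm t h k e; apply: pb_uniq (e); apply: mm.
by rewrite !compA pb_comm -!compA e.
Qed.

(** The equalizer of u and v, obtained as the pullback of <1, u> and <1, v>, is
    a monomorphism through which both f and g factor. *)
Lemma jointly_strong_epi (a a' b d : X) (f : a ~> b) (g : a' ~> b)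
    (u v : b ~> d) :
  jointly_strong f g -> u ∘ f = v ∘ f -> u ∘ g = v ∘ g -> u = v.
Proof.
move=> fg ef eg.
pose (m := pb1 (bpair (idm b) u) (bpair (idm b) v)).
have E : bpair (idm b) u ∘ m = bpair (idm b) v ∘ pb2 _ _ by exact: pb_comm.
have m12 : m = pb2 (bpair (idm b) u) (bpair (idm b) v).
  have := f_equal (fun z => pr1 b d ∘ z) E.
  by rewrite /= !pr1_bpairA !comp1m.
have {}E : u ∘ m = v ∘ m.
  have := f_equal (fun z => pr2 b d ∘ z) E.
  by rewrite /= !pr2_bpairA -m12.
have mm : is_mono m by move=> t h k e; apply: pb_uniq (e) _; rewrite -m12.
have F t (h : t ~> b) : u ∘ h = v ∘ h -> factors m (idm b ∘ h).
  move=> e; have e' : bpair (idm b) u ∘ h = bpair (idm b) v ∘ h.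
    by apply: bprod_uniq; cat_simpl.
  by exists (pb_pair e'); rewrite pb1_pair comp1m.
have [s ms] := fg _ _ m (idm b) mm (F _ _ ef) (F _ _ eg).
by rewrite -[u]compm1 -[v]compm1 -ms !compA E.
Qed.

Lemma strong_epi_epi (a b d : X) (q : a ~> b) (u v : b ~> d) :
  strong_epi q -> u ∘ q = v ∘ q -> u = v.
Proof.
move=> sq e; have jq : jointly_strong q q by move=> M D m w mm E _; exact: sq E.
exact: (jointly_strong_epi jq e e).
Qed.

Lemma coim_map_strong (a b : X) (f : a ~> b) : strong_epi (coim_map f).
Proof.
move=> M D m v mm [t e].
have e' : t ∘ pb1 f f = t ∘ pb2 f f.
  by apply: mm; rewrite !compA e -!compA coim_comm.
by exists (coim_desc e'); apply: coim_uniq; rewrite -compA coim_descE.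
Qed.

Lemma im_coim (a b : X) (f : a ~> b) : im_map f ∘ coim_map f = f.
Proof. exact: coim_descE. Qed.

Lemma regular_epi_strong (a b : X) (q : a ~> b) :
  is_regular_epi q -> strong_epi q.
Proof.
move=> [z [f [g [efg U]]]] M D m v mm [t et].
have [|k [kq _]] := U M t.
  by apply: mm; rewrite !compA et -!compA efg.
exists k; apply: (regular_epi_epi (q := q)); first by exists z, f, g.
by rewrite -compA kq.
Qed.

(** A strong epimorphism is, up to an isomorphism, the quotient by its kernel
    pair, because its image is the whole codomain. *)
Lemma strong_epi_desc (a b d : X) (q : a ~> b) (h : a ~> d) :
  strong_epi q -> h ∘ pb1 q q = h ∘ pb2 q q -> exists k, k ∘ q = h.
Proof.
move=> sq e.
have [|s es] := sq _ _ (im_map q) (idm b) (@im_map_mono _ _ _ q).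
  by exists (coim_map q); rewrite comp1m im_coim.
have se : s ∘ q = coim_map q.
  by apply: im_map_mono; rewrite compA es comp1m im_coim.
by exists (coim_desc e ∘ s); rewrite -compA se coim_descE.
Qed.

(** This is where protomodularity is used.  A monomorphism n into a through
    which the kernel and the section factor is a morphism of points over b
    that becomes invertible after pulling back along 0 -> b, so it is
    invertible.  The morphism g may be larger than the kernel: for a fibre
    product it is the whole inclusion of the first point. *)
Lemma split_jointly_strong (a b k : X) (f : a ~> b) (r : b ~> a) (g : k ~> a) :
  f ∘ r = idm b -> factors g (kernel f) -> jointly_strong g r.
Proof.
move=> fr [kg ekg] M D m v mm vg [r' er'].
have [k' ek'] : factors m (v ∘ kernel f).
  by rewrite -ekg compA; exact: factors_comp.
pose (n := pb2 m v); have nm : is_mono n := pb2_mono mm.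
have er : n ∘ pb_pair er' = r by rewrite pb2_pair.
have ek : n ∘ pb_pair ek' = kernel f by rewrite pb2_pair.
have fnr : (f ∘ n) ∘ pb_pair er' = idm b by rewrite -compA er.
pose N := Point fnr; pose A := Point fr.
pose h : point_hom N A := @PointHom _ _ N A n erefl er.
(* over the zero object, n becomes the inclusion between the two kernels *)
have : is_iso (fmap (pullback_functor (from_zero b)) (h : (N : Pt b) ~> A)).
  have ek2 : (f ∘ n) ∘ pb_pair ek' = from_zero b ∘ to_zero _.
    by rewrite -compA ek comp_kernel.
  have e1 : pt_epi (pt_pullback (from_zero b) N) ∘ pb_pair ek2
      = pt_epi (pt_pullback (from_zero b) A) by exact: to_zero_uniq.
  have e2 : pb_pair ek2 ∘ pt_sec (pt_pullback (from_zero b) A)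
      = pt_sec (pt_pullback (from_zero b) N) by exact: from_zero_uniq.
  exists (@PointHom _ _ (pt_pullback (from_zero b) A)
    (pt_pullback (from_zero b) N) _ e1 e2); split; apply: point_hom_eq;
    apply: pb_uniq => /=; try exact: to_zero_uniq.
  - by apply: nm; cat_simpl.
  - by cat_simpl.
move/sa_protomodular => [g' [_ /(f_equal (fun z => pt_map z)) /= ng]].
exists (pb1 m v ∘ g'); rewrite compA pb_comm -compA.
by rewrite -/n ng compm1.
Qed.

(** The first projection of the kernel pair of q is split by the diagonal and
    its kernel is <0, ker q>; both projections have the same composite with h
    on each of these two jointly epic parts. *)
Lemma strong_epi_cokernel (a b d : X) (q : a ~> b) (h : a ~> d) :
  strong_epi q -> h ∘ kernel q = zero_mor _ d -> exists k, k ∘ q = h.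
Proof.
move=> sq hk; apply: strong_epi_desc => //.
have er : q ∘ idm a = q ∘ idm a by [].
have ek : q ∘ zero_mor _ a = q ∘ kernel q by cat_simpl.
have js : jointly_strong (pb_pair ek) (pb_pair er).
  apply: (@split_jointly_strong _ _ _ (pb1 q q)); first by cat_simpl.
  have [|t et] := @factors_kernel X _ _ _ _ _ q (pb2 q q ∘ kernel (pb1 q q)).
    by rewrite compA -pb_comm -compA comp_kernel compm0.
  by exists t; apply: pb_uniq; cat_simpl.
by apply: (jointly_strong_epi js); cat_simpl.
Qed.

Lemma jointly_strong_in (a b : X) : jointly_strong (in1 a b) (in2 a b).
Proof.
move=> M D m v _ [t et] [s es]; exists (copair t s).
by apply: bcoprod_uniq; cat_simpl.
Qed.

Lemma jointly_strong_bprod (a b : X) :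
  jointly_strong (bpair (idm a) (zero_mor a b)) (bpair (zero_mor b a) (idm b)).
Proof.
apply: (@split_jointly_strong _ _ _ (pr2 a b)); first by cat_simpl.
by exists (pr1 a b ∘ kernel (pr2 a b)); apply: bprod_uniq; cat_simpl.
Qed.

(** The projection of the fibre product to A' is split by the second inclusion,
    and its kernel is the kernel of A -> B, which lies in the first one. *)
Lemma jointly_strong_incl (B : X) (A A' : point B) :
  jointly_strong (pt_incl1 A A') (pt_incl2 A A').
Proof.
apply: (@split_jointly_strong _ _ _ (pb2 (pt_epi A) (pt_epi A'))).
  by rewrite /pt_incl2; cat_simpl.
exists (pb1 _ _ ∘ kernel (pb2 (pt_epi A) (pt_epi A'))); rewrite /pt_incl1.
apply: pb_uniq; cat_simpl => //.
by rewrite (compA (pt_epi A)) pb_comm; cat_simpl.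
Qed.

Lemma strong_epi_coprod (a b a' b' : X) (q : a ~> a') (q' : b ~> b') :
  strong_epi q -> strong_epi q' ->
  strong_epi (copair (in1 a' b' ∘ q) (in2 a' b' ∘ q')).
Proof.
move=> sq sq' M D m v mm vq; apply: (jointly_strong_in mm).
- apply: sq => //; have := factors_comp (in1 a b) vq.
  by rewrite -!compA copair_in1.
- apply: sq' => //; have := factors_comp (in2 a b) vq.
  by rewrite -!compA copair_in2.
Qed.

(** * Commuting on a fibre product of points *)

(** Morphisms of points are needed here over a varying base, since the weight
    is replaced by its image and the base by the zero object. *)
Definition over_base {B B' : X} (c : B ~> B') (A : point B) (A' : point B')
    (q : (A : X) ~> A') : Prop :=
  pt_epi A' ∘ q = c ∘ pt_epi A /\ q ∘ pt_sec A = pt_sec A' ∘ c.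

Definition commute_on {B D : X} (A A' : point B) (u : (A : X) ~> D)
    (v : (A' : X) ~> D) : Prop :=
  exists phi : pb (pt_epi A) (pt_epi A') ~> D,
    phi ∘ pt_incl1 A A' = u /\ phi ∘ pt_incl2 A A' = v.

Section BaseChange.
Context (B B' : X) (c : B ~> B') (A1 A2 : point B) (A1' A2' : point B').
Context (q1 : (A1 : X) ~> A1') (q2 : (A2 : X) ~> A2').
Context (o1 : over_base c q1) (o2 : over_base c q2).

Lemma base_change_comm :
  pt_epi A1' ∘ (q1 ∘ pb1 (pt_epi A1) (pt_epi A2)) =
  pt_epi A2' ∘ (q2 ∘ pb2 (pt_epi A1) (pt_epi A2)).
Proof. by rewrite !compA o1.1 o2.1 -!compA pb_comm. Qed.

Definition base_change := pb_pair base_change_comm.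

Lemma base_change_incl1 :
  base_change ∘ pt_incl1 A1 A2 = pt_incl1 A1' A2' ∘ q1.
Proof.
rewrite /base_change /pt_incl1; apply: pb_uniq; cat_simpl => //.
by rewrite o1.1 !compA o2.2.
Qed.

Lemma base_change_incl2 :
  base_change ∘ pt_incl2 A1 A2 = pt_incl2 A1' A2' ∘ q2.
Proof.
rewrite /base_change /pt_incl2; apply: pb_uniq; cat_simpl => //.
by rewrite o2.1 !compA o1.2.
Qed.

Lemma commute_on_comp (D : X) (u : (A1' : X) ~> D) (v : (A2' : X) ~> D) :
  commute_on u v -> commute_on (u ∘ q1) (v ∘ q2).
Proof.
move=> [phi [<- <-]]; exists (phi ∘ base_change).
by rewrite -!compA base_change_incl1 base_change_incl2.
Qed.

End BaseChange.

Lemma commute_on_uniq (B D : X) (A A' : point B)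
    (phi psi : pb (pt_epi A) (pt_epi A') ~> D) :
  phi ∘ pt_incl1 A A' = psi ∘ pt_incl1 A A' ->
  phi ∘ pt_incl2 A A' = psi ∘ pt_incl2 A A' -> phi = psi.
Proof. exact: jointly_strong_epi (@jointly_strong_incl B A A'). Qed.

(** Kernel pairs are made into points so that the joint epicness of the two
    inclusions into a fibre product can be applied to them as well. *)
Section KernelPairPoint.
Context (B B' : X) (c : B ~> B') (A : point B) (A' : point B').
Context (q : (A : X) ~> A') (o : over_base c q).

Lemma kernel_pair_epi_comm :
  c ∘ (pt_epi A ∘ pb1 q q) = c ∘ (pt_epi A ∘ pb2 q q).
Proof. by rewrite !compA -o.1 -!compA pb_comm. Qed.

Lemma kernel_pair_sec_comm :
  q ∘ (pt_sec A ∘ pb1 c c) = q ∘ (pt_sec A ∘ pb2 c c).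
Proof. by rewrite !compA o.2 -!compA pb_comm. Qed.

Lemma kernel_pair_epi_sec :
  pb_pair kernel_pair_epi_comm ∘ pb_pair kernel_pair_sec_comm = idm (pb c c).
Proof. by apply: pb_uniq; cat_simpl. Qed.

Definition kernel_pair_point : point (pb c c) := Point kernel_pair_epi_sec.

Lemma over_base_pb1 :
  @over_base _ _ (pb1 c c) kernel_pair_point A (pb1 q q).
Proof. by split; cat_simpl. Qed.

Lemma over_base_pb2 :
  @over_base _ _ (pb2 c c) kernel_pair_point A (pb2 q q).
Proof. by split; cat_simpl. Qed.

End KernelPairPoint.

(** The map Q between the fibre products is a strong epimorphism, so it has to
    be shown that phi coequalizes its kernel pair.  That kernel pair lies in
    the fibre product of the kernel pairs of q1 and q2, where the two
    inclusions are again jointly epic; on each of them phi is given by u or v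
    composed with q1 or q2, which do not distinguish the projections. *)
Lemma commute_on_desc (B B' D : X) (c : B ~> B') (A1 A2 : point B)
    (A1' A2' : point B') (q1 : (A1 : X) ~> A1') (q2 : (A2 : X) ~> A2')
    (u : (A1' : X) ~> D) (v : (A2' : X) ~> D) :
  over_base c q1 -> over_base c q2 -> strong_epi q1 -> strong_epi q2 ->
  commute_on (u ∘ q1) (v ∘ q2) -> commute_on u v.
Proof.
move=> o1 o2 s1 s2 [phi [e1 e2]].
pose (Q := base_change o1 o2).
have Q1 := base_change_incl1 o1 o2 : Q ∘ _ = _.
have Q2 := base_change_incl2 o1 o2 : Q ∘ _ = _.
have sQ : strong_epi Q.
  move=> M T m w mm wQ; apply: (jointly_strong_incl mm).
  - by apply: s1 => //; rewrite -compA -Q1 compA; exact: factors_comp.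
  - by apply: s2 => //; rewrite -compA -Q2 compA; exact: factors_comp.
pose (N1 := kernel_pair_point o1); pose (N2 := kernel_pair_point o2).
pose (d1 := base_change (over_base_pb1 o1) (over_base_pb1 o2)).
pose (d2 := base_change (over_base_pb2 o1) (over_base_pb2 o2)).
have ed : phi ∘ d1 = phi ∘ d2.
  apply: commute_on_uniq; rewrite -!compA ?base_change_incl1 ?base_change_incl2.
  - by rewrite !compA e1 -!compA pb_comm.
  - by rewrite !compA e2 -!compA pb_comm.
have [k ek] : exists k, k ∘ Q = phi.
  apply: strong_epi_desc => //.
  have k1 : q1 ∘ (pb1 _ _ ∘ pb1 Q Q) = q1 ∘ (pb1 _ _ ∘ pb2 Q Q).
    have : pb1 (pt_epi A1') (pt_epi A2') ∘ (Q ∘ pb1 Q Q)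
        = pb1 (pt_epi A1') (pt_epi A2') ∘ (Q ∘ pb2 Q Q) by rewrite pb_comm.
    by rewrite /Q /base_change !pb1_pairA -!compA.
  have k2 : q2 ∘ (pb2 _ _ ∘ pb1 Q Q) = q2 ∘ (pb2 _ _ ∘ pb2 Q Q).
    have : pb2 (pt_epi A1') (pt_epi A2') ∘ (Q ∘ pb1 Q Q)
        = pb2 (pt_epi A1') (pt_epi A2') ∘ (Q ∘ pb2 Q Q) by rewrite pb_comm.
    by rewrite /Q /base_change !pb2_pairA -!compA.
  have kN : pt_epi N1 ∘ pb_pair k1 = pt_epi N2 ∘ pb_pair k2.
    by apply: pb_uniq; cat_simpl; rewrite !compA pb_comm.
  have [n [-> ->]] : exists n, pb1 Q Q = d1 ∘ n /\ pb2 Q Q = d2 ∘ n.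
    exists (pb_pair kN); rewrite /d1 /d2 /base_change.
    by split; apply: pb_uniq; cat_simpl.
  by rewrite !compA ed.
exists k; split.
- by apply: (strong_epi_epi s1); rewrite -compA -Q1 compA ek.
- by apply: (strong_epi_epi s2); rewrite -compA -Q2 compA ek.
Qed.

(** * Huq-commutativity and commutation over a weight *)

Definition zero_point (a : X) : point (zero_obj : X) :=
  Point (from_zero_uniq (to_zero a ∘ from_zero a) (idm zero_obj)).

Lemma over_base_zero (B a : X) (A : point B) (q : a ~> A) :
  pt_epi A ∘ q = zero_mor a B ->
  @over_base _ _ (from_zero B) (zero_point a) A q.
Proof. by move=> e; split=> //; exact: from_zero_uniq. Qed.

Lemma over_base_to_zero (B a : X) (A : point B) (q : (A : X) ~> a) :
  q ∘ pt_sec A = zero_mor B a ->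
  @over_base _ _ (to_zero B) A (zero_point a) q.
Proof. by move=> e; split=> //; exact: to_zero_uniq. Qed.

Lemma over_base_coprod (W W' U U' : X) (w : W ~> W') (q : U ~> U') :
  @over_base _ _ w (coprod_point W U) (coprod_point W' U')
    (copair (in1 W' U' ∘ w) (in2 W' U' ∘ q)).
Proof. by split; rewrite /= ?copair_in1 //; apply: bcoprod_uniq; cat_simpl. Qed.

Lemma huq_commute_on (U V D : X) (x : U ~> D) (y : V ~> D) :
  huq_commute x y <-> @commute_on _ _ (zero_point U) (zero_point V) x y.
Proof.
split=> -[phi [<- <-]].
- exists (phi ∘ bpair (pb1 _ _) (pb2 _ _)); rewrite /pt_incl1 /pt_incl2.
  by split; rewrite -compA; congr (_ ∘ _); apply: bprod_uniq; cat_simpl.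
- have e : to_zero U ∘ pr1 U V = to_zero V ∘ pr2 U V by exact: to_zero_uniq.
  exists (phi ∘ pb_pair e); rewrite /pt_incl1 /pt_incl2.
  by split; rewrite -compA; congr (_ ∘ _); apply: pb_uniq; cat_simpl.
Qed.

Lemma over_base_zero_points (a b : X) (q : a ~> b) :
  @over_base _ _ (idm zero_obj) (zero_point a) (zero_point b) q.
Proof. by split; [exact: to_zero_uniq | exact: from_zero_uniq]. Qed.

Lemma huq_commute_im (U V D : X) (x : U ~> D) (y : V ~> D) :
  huq_commute x y <-> huq_commute (im_map x) (im_map y).
Proof.
split=> /huq_commute_on c; apply/huq_commute_on.
- apply: (commute_on_desc (over_base_zero_points (coim_map x))
    (over_base_zero_points (coim_map y)));
    rewrite ?im_coim //; exact: coim_map_strong.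
- rewrite -(im_coim x) -(im_coim y).
  exact: (commute_on_comp (over_base_zero_points _) (over_base_zero_points _) c).
Qed.

Lemma huq_commute_comp (U V U' V' D D' : X) (x : U ~> D) (y : V ~> D)
    (a : U' ~> U) (b : V' ~> V) (d : D ~> D') :
  huq_commute x y -> huq_commute (d ∘ x ∘ a) (d ∘ y ∘ b).
Proof.
move=> /huq_commute_on [phi [e1 e2]]; apply/huq_commute_on.
apply: (commute_on_comp (over_base_zero_points a) (over_base_zero_points b)).
by exists (d ∘ phi); rewrite -!compA e1 e2.
Qed.

Lemma commute_overE (U V W D : X) (x : U ~> D) (y : V ~> D) (w : W ~> D) :
  commute_over x y w =
  @commute_on W D (coprod_point W U) (coprod_point W V)
    (copair w x) (copair w y).
Proof. by []. Qed.

Lemma commute_over_im (U V W D : X) (x : U ~> D) (y : V ~> D) (w : W ~> D) :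
  commute_over x y w <-> commute_over (im_map x) (im_map y) (im_map w).
Proof.
have E a (z : a ~> D) : copair w z = copair (im_map w) (im_map z) ∘
    copair (in1 _ _ ∘ coim_map w) (in2 _ _ ∘ coim_map z).
  by apply: bcoprod_uniq; cat_simpl; rewrite im_coim.
have s a (z : a ~> D) : strong_epi
    (copair (in1 _ _ ∘ coim_map w) (in2 _ _ ∘ coim_map z)).
  by apply: strong_epi_coprod; exact: coim_map_strong.
rewrite !commute_overE !E; split=> c.
- exact: (commute_on_desc (over_base_coprod (coim_map w) (coim_map x))
    (over_base_coprod (coim_map w) (coim_map y)) (s _ _) (s _ _) c).
- exact: (commute_on_comp (over_base_coprod _ _) (over_base_coprod _ _) c).
Qed.

Lemma commute_over_huq (U V W D : X) (x : U ~> D) (y : V ~> D) (w : W ~> D) :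
  commute_over x y w -> huq_commute x y.
Proof.
move=> c; rewrite huq_commute_on -(copair_in2 w x) -(copair_in2 w y).
by apply: commute_on_comp c; apply: over_base_zero; rewrite /= copair_in2.
Qed.

Lemma huq_commute_over_zero (U V D : X) (x : U ~> D) (y : V ~> D) :
  huq_commute x y -> commute_over x y (from_zero D).
Proof.
move=> /huq_commute_on c.
have E a (z : a ~> D) :
    copair (from_zero D) z = z ∘ copair (zero_mor zero_obj a) (idm a).
  by apply: bcoprod_uniq; cat_simpl => //; exact: from_zero_uniq.
rewrite commute_overE !E.
by apply: commute_on_comp c; apply: over_base_to_zero; rewrite /= copair_in1.
Qed.

(** * Higgins commutators *)

Lemma im_zero (a D : X) (f : a ~> D) :
  sub_eq (Im f) (sub_zero D) <-> f = zero_mor a D.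
Proof.
split=> [[[h /= e] _]|e].
  by rewrite -(im_coim f) -e from_zero_comp comp0m.
split; last by exists (from_zero _); exact: from_zero_uniq.
rewrite -[sub_le _ _]/(factors (from_zero D) (im_map f)).
apply: (@coim_map_strong _ _ f); first exact: from_zero_mono.
by rewrite im_coim e; exists (to_zero a).
Qed.

Lemma coprod_to_prod_in1 (K L : X) :
  coprod_to_prod K L ∘ in1 K L = bpair (idm K) (zero_mor K L).
Proof. by apply: bprod_uniq; rewrite /coprod_to_prod; cat_simpl. Qed.

Lemma coprod_to_prod_in2 (K L : X) :
  coprod_to_prod K L ∘ in2 K L = bpair (zero_mor L K) (idm L).
Proof. by apply: bprod_uniq; rewrite /coprod_to_prod; cat_simpl. Qed.

Lemma coprod_to_prod_strong (K L : X) : strong_epi (coprod_to_prod K L).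
Proof.
move=> M D m v mm vq; apply: (jointly_strong_bprod mm).
- by rewrite -coprod_to_prod_in1 compA; exact: factors_comp.
- by rewrite -coprod_to_prod_in2 compA; exact: factors_comp.
Qed.

Lemma factors_diamond (K L t : X) (h : t ~> bcoprod K L) :
  copair (idm K) (zero_mor L K) ∘ h = zero_mor t K ->
  copair (zero_mor K L) (idm L) ∘ h = zero_mor t L ->
  factors (kernel (coprod_to_prod K L)) h.
Proof.
move=> e1 e2; apply: factors_kernel; rewrite /coprod_to_prod.
by apply: bprod_uniq; cat_simpl.
Qed.

Lemma diamond_kernel1 (K L : X) :
  copair (idm K) (zero_mor L K) ∘ kernel (coprod_to_prod K L) = zero_mor _ K.
Proof.
rewrite -[RHS](compm0 _ (pr1 K L)) -(comp_kernel (coprod_to_prod K L)).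
by rewrite /coprod_to_prod; cat_simpl.
Qed.

Lemma diamond_kernel2 (K L : X) :
  copair (zero_mor K L) (idm L) ∘ kernel (coprod_to_prod K L) = zero_mor _ L.
Proof.
rewrite -[RHS](compm0 _ (pr2 K L)) -(comp_kernel (coprod_to_prod K L)).
by rewrite /coprod_to_prod; cat_simpl.
Qed.

(** The comparison U + V -> U x V is a strong epimorphism, hence the cokernel of
    the diamond of U and V. *)
Lemma huq_commute_diamond (U V D : X) (x : U ~> D) (y : V ~> D) :
  huq_commute x y <-> copair x y ∘ kernel (coprod_to_prod U V) = zero_mor _ D.
Proof.
split=> [[phi [<- <-]]|].
  rewrite -coprod_to_prod_in1 -coprod_to_prod_in2 !compA -comp_copair.
  have -> : copair (in1 U V) (in2 U V) = idm _.
    by apply: bcoprod_uniq; cat_simpl.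
  by rewrite compm1 -compA comp_kernel compm0.
move/(strong_epi_cokernel (@coprod_to_prod_strong U V)) => [phi e].
exists phi; rewrite -coprod_to_prod_in1 -coprod_to_prod_in2 !compA e.
by rewrite copair_in1 copair_in2.
Qed.

(** W + U and W + V generate the fibre product (W + U) x_W (W + V) and share the
    summand W, so the fibre product is a quotient of U + V + W: extending
    <w; x> and <w; y> to it amounts to killing the kernel of this quotient. *)
Section TernaryCommutator.
Context (U V W D : X) (x : U ~> D) (y : V ~> D) (w : W ~> D).

Let P := pb (pt_epi (coprod_point W U)) (pt_epi (coprod_point W V)).
Let e1 : bcoprod W U ~> P := pt_incl1 (coprod_point W U) (coprod_point W V).
Let e2 : bcoprod W V ~> P := pt_incl2 (coprod_point W U) (coprod_point W V).

Definition coprod3_to_pb : bcoprod (bcoprod U V) W ~> P :=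
  copair3 (e1 ∘ in2 W U) (e2 ∘ in2 W V) (e1 ∘ in1 W U).

Lemma incl_in1 : e1 ∘ in1 W U = e2 ∘ in1 W V.
Proof. by rewrite /e1 /e2 /pt_incl1 /pt_incl2; apply: pb_uniq; cat_simpl. Qed.

Lemma coprod3_to_pb_strong : strong_epi coprod3_to_pb.
Proof.
move=> M T m v mm vq.
have f t (h : t ~> _) : factors m (v ∘ (coprod3_to_pb ∘ h)).
  by rewrite compA; exact: factors_comp.
have fU : factors m (v ∘ e1 ∘ in2 W U).
  by have := f _ (in1 _ _ ∘ in1 _ _); rewrite /coprod3_to_pb /copair3; cat_simpl.
have fV : factors m (v ∘ e2 ∘ in2 W V).
  by have := f _ (in1 _ _ ∘ in2 _ _); rewrite /coprod3_to_pb /copair3; cat_simpl.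
have fW : factors m (v ∘ e1 ∘ in1 W U).
  by have := f _ (in2 _ _); rewrite /coprod3_to_pb /copair3; cat_simpl.
apply: (jointly_strong_incl mm); apply: (jointly_strong_in mm) => //.
by rewrite -compA -incl_in1 compA.
Qed.

Lemma coprod3_to_pb1 :
  pb1 _ _ ∘ coprod3_to_pb = copair3 (in2 W U) (zero_mor V _) (in1 W U).
Proof.
rewrite /coprod3_to_pb /copair3 !comp_copair /e1 /e2 /pt_incl1 /pt_incl2.
by congr copair; first congr copair; cat_simpl.
Qed.

Lemma coprod3_to_pb2 :
  pb2 _ _ ∘ coprod3_to_pb = copair3 (zero_mor U _) (in2 W V) (in1 W V).
Proof.
rewrite /coprod3_to_pb /copair3 !comp_copair /e1 /e2 /pt_incl1 /pt_incl2.
by congr copair; first congr copair; cat_simpl.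
Qed.

(** The two components of the quotient map are, up to exchanging summands, two
    of the three components of the map that defines the ternary diamond. *)
Lemma coprod3_to_pb_eq0 t (h : t ~> bcoprod (bcoprod U V) W) :
  coprod3_to_pb ∘ h = zero_mor _ _ <->
  copair3 (in1 U W) (zero_mor V _) (in2 U W) ∘ h = zero_mor _ _ /\
  copair3 (zero_mor U _) (in1 V W) (in2 V W) ∘ h = zero_mor _ _.
Proof.
have s1 : copair (in2 W U) (in1 W U) ∘ copair3 (in1 U W) (zero_mor V _) (in2 U W)
  = copair3 (in2 W U) (zero_mor V _) (in1 W U).
  by rewrite /copair3 !comp_copair; cat_simpl.
have s2 : copair (in2 W V) (in1 W V) ∘ copair3 (zero_mor U _) (in1 V W) (in2 V W)
  = copair3 (zero_mor U _) (in2 W V) (in1 W V).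
  by rewrite /copair3 !comp_copair; cat_simpl.
have t1 : copair (in2 U W) (in1 U W) ∘ copair3 (in2 W U) (zero_mor V _) (in1 W U)
  = copair3 (in1 U W) (zero_mor V _) (in2 U W).
  by rewrite /copair3 !comp_copair; cat_simpl.
have t2 : copair (in2 V W) (in1 V W) ∘ copair3 (zero_mor U _) (in2 W V) (in1 W V)
  = copair3 (zero_mor U _) (in1 V W) (in2 V W).
  by rewrite /copair3 !comp_copair; cat_simpl.
split=> [e|[f1 f2]].
  rewrite -t1 -t2 -coprod3_to_pb1 -coprod3_to_pb2 -!compA e.
  by rewrite !compm0.
apply: pb_uniq; rewrite compA ?coprod3_to_pb1 ?coprod3_to_pb2 compm0.
- by rewrite -s1 -compA f1 compm0.
- by rewrite -s2 -compA f2 compm0.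
Qed.

(** Let K be the kernel of U + V + W -> (W + U) x_W (W + V).  Sending W to zero
    maps K onto the diamond of U and V, split by the inclusion of U + V, and
    what is left in the kernel is the ternary diamond.  Hence <x; y; w> kills K
    if and only if it kills both diamonds. *)
Lemma commute_over_diamond :
  commute_over x y w <->
  huq_commute x y /\
  copair3 x y w ∘ kernel (coprod3_to_prod3 U V W) = zero_mor _ D.
Proof.
split=> [c|[hxy h3]].
  split; first exact: commute_over_huq c.
  have [phi [f1 f2]] := c.
  have -> : copair3 x y w = phi ∘ coprod3_to_pb.
    rewrite /coprod3_to_pb /copair3 !comp_copair !compA.
    by rewrite (f1 : phi ∘ e1 = _) (f2 : phi ∘ e2 = _) !catE.
  rewrite -compA (_ : coprod3_to_pb ∘ _ = zero_mor _ _) ?compm0 //.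
  apply/coprod3_to_pb_eq0; set k := kernel _.
  have k0 : coprod3_to_prod3 U V W ∘ k = zero_mor _ _ by exact: comp_kernel.
  split.
  - have := f_equal (fun z => pr2 _ _ ∘ (pr1 _ _ ∘ z)) k0.
    by rewrite /= /coprod3_to_prod3 !catE.
  - have := f_equal (fun z => pr2 _ _ ∘ z) k0.
    by rewrite /= /coprod3_to_prod3 !catE.
suff [phi e] : exists phi, phi ∘ coprod3_to_pb = copair3 x y w.
  have g t (h : t ~> _) : phi ∘ (coprod3_to_pb ∘ h) = copair3 x y w ∘ h.
    by rewrite compA e.
  have gU : phi ∘ (e1 ∘ in2 W U) = x.
    by have := g _ (in1 _ _ ∘ in1 _ _); rewrite /coprod3_to_pb /copair3 !catE.
  have gV : phi ∘ (e2 ∘ in2 W V) = y.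
    by have := g _ (in1 _ _ ∘ in2 _ _); rewrite /coprod3_to_pb /copair3 !catE.
  have gW : phi ∘ (e1 ∘ in1 W U) = w.
    by have := g _ (in2 _ _); rewrite /coprod3_to_pb /copair3 !catE.
  exists phi; split; apply: bcoprod_uniq; rewrite -compA ?copair_in1 ?copair_in2 //.
  by rewrite -incl_in1.
apply: (strong_epi_cokernel coprod3_to_pb_strong).
pose (k := kernel coprod3_to_pb).
have [k1 k2] : copair3 (in1 U W) (zero_mor V _) (in2 U W) ∘ k = zero_mor _ _ /\
  copair3 (zero_mor U _) (in1 V W) (in2 V W) ∘ k = zero_mor _ _.
  by apply/coprod3_to_pb_eq0; exact: comp_kernel.
pose (p := copair (idm (bcoprod U V)) (zero_mor W _)).
(* f is the projection of K onto the diamond of U and V, and r splits it *)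
have [f ef] : factors (kernel (coprod_to_prod U V)) (p ∘ k).
  apply: factors_diamond.
  - rewrite -[RHS](compm0 _ (copair (idm U) (zero_mor W U))) -k1 !compA.
    congr (_ ∘ _); rewrite /p /copair3 !comp_copair.
    by congr copair; cat_simpl.
  - rewrite -[RHS](compm0 _ (copair (idm V) (zero_mor W V))) -k2 !compA.
    congr (_ ∘ _); rewrite /p /copair3 !comp_copair.
    by congr copair; cat_simpl.
have [r er] : factors k (in1 _ W ∘ kernel (coprod_to_prod U V)).
  apply: factors_kernel; apply/coprod3_to_pb_eq0; split.
  - have -> : copair3 (in1 U W) (zero_mor V _) (in2 U W) ∘ (in1 (bcoprod U V) W
      ∘ kernel (coprod_to_prod U V)) = in1 U W ∘ (copair (idm U) (zero_mor V U)
      ∘ kernel (coprod_to_prod U V)).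
      by rewrite /copair3 copair_in1A compA comp_copair compm0 compm1.
    by rewrite diamond_kernel1 compm0.
  - have -> : copair3 (zero_mor U _) (in1 V W) (in2 V W) ∘ (in1 (bcoprod U V) W
      ∘ kernel (coprod_to_prod U V)) = in1 V W ∘ (copair (zero_mor U V) (idm V)
      ∘ kernel (coprod_to_prod U V)).
      by rewrite /copair3 copair_in1A compA comp_copair compm0 compm1.
    by rewrite diamond_kernel2 compm0.
have fr : f ∘ r = idm _.
  apply: (@kernel_mono X _ _ _ _ (coprod_to_prod U V)).
  by rewrite compA ef -compA er /p; cat_simpl.
have js := split_jointly_strong fr (ex_intro _ (idm _) (compm1 _)).
apply: (jointly_strong_epi js); rewrite -compA.
- have [|t <-] := @factors_kernel X _ _ _ _ _ (coprod3_to_prod3 U V W)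
    (k ∘ kernel f).
    rewrite /coprod3_to_prod3; apply: bprod_uniq; first apply: bprod_uniq;
      cat_simpl.
    + have -> : copair3 (in1 U V) (in2 U V) (zero_mor W _) = p.
        by rewrite /copair3 /p; congr copair; apply: bcoprod_uniq; cat_simpl.
      by rewrite compA -ef -compA comp_kernel compm0.
    + by rewrite compA k1 comp0m.
    + by rewrite compA k2 comp0m.
  by rewrite compA h3 !comp0m.
- rewrite er compA comp0m /copair3 copair_in1.
  exact/huq_commute_diamond.
Qed.

End TernaryCommutator.

Lemma ternary_commutator_zero (U V W D : X) (x : U ~> D) (y : V ~> D)
    (w : W ~> D) :
  huq_commute x y ->
  (commute_over x y w <->
   sub_eq (higgins3 (Im x) (Im y) (Im w)) (sub_zero D)).
Proof.
move=> /huq_commute_im hxy; rewrite im_zero commute_over_im.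
by rewrite commute_over_diamond; split=> [[]|].
Qed.

Lemma huq_commute_commutator (U V D : X) (x : U ~> D) (y : V ~> D) :
  huq_commute x y <-> sub_eq (higgins2 (Im x) (Im y)) (sub_zero D).
Proof. by rewrite im_zero huq_commute_im huq_commute_diamond. Qed.

Lemma w_normal_zero (U D : X) (x : U ~> D) : w_normal (from_zero D) (Im x).
Proof.
rewrite /w_normal -[sub_le _ _]/(factors (im_map x) (im_map _)).
apply: (@coim_map_strong _ _ _); first exact: im_map_mono.
rewrite im_coim; set k := kernel _.
have -> : copair (im_map (from_zero D)) (im_map x) =
  im_map x ∘ copair (zero_mor _ _) (idm _).
  apply: bcoprod_uniq; cat_simpl => //.
  apply: (@strong_epi_epi _ _ _ (coim_map (from_zero D))).
    exact: coim_map_strong.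
  exact: from_zero_uniq.
by rewrite -compA; exists (copair (zero_mor _ _) (idm _) ∘ k).
Qed.

(** * Normality and kernels of points *)

(** The kernel of W + U -> W projects onto U, split by the inclusion of U, and
    the kernel of this projection is the diamond of W and U.  On U the map
    <w; x> is x; on the diamond it takes values in [Im w, Im x]. *)
Lemma factors_conjugation (U W D : X) (x : U ~> D) (w : W ~> D) :
  w_normal w (Im x) ->
  factors (im_map x) (copair w x ∘ kernel (copair (idm W) (zero_mor U W))).
Proof.
move=> nx; pose (k := kernel (copair (idm W) (zero_mor U W))).
have [|r er] := @factors_kernel X _ _ _ _ _ (copair (idm W) (zero_mor U W))
  (in2 W U); first by rewrite copair_in2.
pose (f := copair (zero_mor W U) (idm U) ∘ k).
have fr : f ∘ r = idm _ by rewrite /f -compA er copair_in2.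
have js := split_jointly_strong fr (ex_intro _ (idm _) (compm1 _)).
apply: js; first exact: im_map_mono; rewrite -compA; last first.
  by rewrite er copair_in2; exists (coim_map x); exact: im_coim.
pose (q := copair (in1 (coim w) (coim x) ∘ coim_map w) (in2 _ _ ∘ coim_map x)).
have -> : copair w x = copair (im_map w) (im_map x) ∘ q.
  by apply: bcoprod_uniq; rewrite /q; cat_simpl; rewrite im_coim.
have k1 : copair (idm W) (zero_mor U W) ∘ k = zero_mor _ _ by exact: comp_kernel.
have k2 : copair (zero_mor W U) (idm U) ∘ (k ∘ kernel f) = zero_mor _ _.
  by rewrite compA comp_kernel.
have [t et] : factors (kernel (coprod_to_prod _ _)) (q ∘ (k ∘ kernel f)).
  apply: factors_diamond; rewrite compA.
  - have -> : copair (idm _) (zero_mor _ _) ∘ q =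
      coim_map w ∘ copair (idm W) (zero_mor U W).
      by rewrite /q !comp_copair; cat_simpl.
    by rewrite -compA (compA _ k) k1 comp0m compm0.
  - have -> : copair (zero_mor _ _) (idm _) ∘ q =
      coim_map x ∘ copair (zero_mor W U) (idm U).
      by rewrite /q !comp_copair; cat_simpl.
    by rewrite -compA k2 compm0.
rewrite -compA -et compA; apply: factors_comp.
rewrite -[copair _ _ ∘ _]im_coim; apply: factors_comp; exact: nx.
Qed.

(** Products of points over B are pullbacks over B, and a morphism phi that
    extends x and y is automatically a morphism of points because the two
    inclusions are jointly epic. *)
Lemma pt_huq_commute (B : X) (A A' D : Pt B) (x : A ~> D) (y : A' ~> D) :
  huq_commute x y <-> commute_on (pt_map x) (pt_map y).
Proof.
have i1 : pt_incl1 A A' =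
    pt_map (pt_pair (idm A : point_hom A A) (zero_mor A A')).
  by rewrite /pt_incl1; apply: pb_uniq => /=; cat_simpl.
have i2 : pt_incl2 A A' =
    pt_map (pt_pair (zero_mor A' A) (idm A' : point_hom A' A')).
  by rewrite /pt_incl2; apply: pb_uniq => /=; cat_simpl.
split=> [[phi [<- <-]]|[phi [e1 e2]]].
  by exists (pt_map phi); rewrite i1 i2.
have he : pt_epi D ∘ phi = pt_epi (pt_prod A A').
  apply: commute_on_uniq; rewrite -compA ?e1 ?e2 pt_map_epi;
    by rewrite /pt_incl1 /pt_incl2; cat_simpl.
have hs : phi ∘ pt_sec (pt_prod A A') = pt_sec D.
  rewrite -(pt_map_sec x) -e1 -compA; congr (_ ∘ _).
  by rewrite /pt_incl1; apply: pb_uniq => /=; cat_simpl.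
exists (@PointHom _ _ (pt_prod A A') D phi he hs); split; apply: point_hom_eq.
- by rewrite -e1 i1.
- by rewrite -e2 i2.
Qed.

(** The kernel of a point embeds in its pullback along p as the part lying over
    the zero of E. *)
Lemma huq_commute_kernels (E B : X) (p : E ~> B) (A A' D : Pt B)
    (x : A ~> D) (y : A' ~> D) :
  huq_commute (fmap (pullback_functor p) x) (fmap (pullback_functor p) y) ->
  huq_commute (pt_map x ∘ kernel (pt_epi A)) (pt_map y ∘ kernel (pt_epi A')).
Proof.
move=> /pt_huq_commute [phi [e1 e2]]; apply/huq_commute_on.
have {}e1 : phi ∘ pt_incl1 (pt_pullback p A) (pt_pullback p A') =
  pb_pair (pt_pullback_map_comm p x) := e1.
have {}e2 : phi ∘ pt_incl2 (pt_pullback p A) (pt_pullback p A') =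
  pb_pair (pt_pullback_map_comm p y) := e2.
have o (T : Pt B) : pt_epi T ∘ kernel (pt_epi T) = p ∘ zero_mor _ E.
  by rewrite comp_kernel compm0.
have c (T : Pt B) : @over_base _ _ (from_zero E) (zero_point _) (pt_pullback p T)
    (pb_pair (o T)).
  by apply: over_base_zero; rewrite /= pb2_pair.
have d : @commute_on _ _ (pt_pullback p A) (pt_pullback p A')
    (pt_map x ∘ pb1 (pt_epi A) p) (pt_map y ∘ pb1 (pt_epi A') p).
  exists (pb1 (pt_epi D) p ∘ phi).
  by rewrite -!compA e1 e2 !pb1_pair.
by have := commute_on_comp (c A) (c A') d; rewrite -!compA !pb1_pair.
Qed.

Lemma kernels_huq_commute (B : X) (A A' D : Pt B) (x : A ~> D) (y : A' ~> D) :
  huq_commute (pt_map x ∘ kernel (pt_epi A)) (pt_map y ∘ kernel (pt_epi A')) ->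
  huq_commute (fmap (pullback_functor (from_zero B)) x)
    (fmap (pullback_functor (from_zero B)) y).
Proof.
move=> /huq_commute_on c; apply/pt_huq_commute.
have o (T : Pt B) : @over_base _ _ (to_zero zero_obj)
    (pt_pullback (from_zero B) T) (zero_point (pb (pt_epi T) (from_zero B)))
    (idm _).
  by split; [exact: to_zero_uniq | exact: from_zero_uniq].
have [phi [e1 e2]] := commute_on_comp (o A) (o A') c.
have e : pt_epi D ∘ phi = from_zero B ∘ to_zero _.
  apply: commute_on_uniq; rewrite -!compA ?e1 ?e2 compm1 from_zero_comp compA;
    by rewrite pt_map_epi comp_kernel.
exists (pb_pair e); split; apply: pb_uniq; try exact: to_zero_uniq;
  by rewrite /= compA !pb1_pair ?e1 ?e2 compm1.
Qed.

(** The regular image of x is again a point over B, and the kernel of its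
    projection g is contained in the image of the kernel of A, since regular
    epimorphisms are stable under pullback.  The section and that kernel both
    lie in the image of x, so <section; kernel> maps their diamond into it;
    there g kills the diamond, because g vanishes on the kernel and the
    projection onto the other summand vanishes on the diamond. *)
Lemma w_normal_kernel (B : X) (A D : point B) (x : point_hom A D) :
  w_normal (pt_sec D) (Im (pt_map x ∘ kernel (pt_epi A))).
Proof.
pose (i := pt_map x ∘ kernel (pt_epi A)).
pose (n := im_map (pt_map x)); pose (g := pt_epi D ∘ n).
have gq : g ∘ coim_map (pt_map x) = pt_epi A.
  by rewrite /g /n -compA im_coim pt_map_epi.
have kI : factors (im_map i) (n ∘ kernel g).
  have s : strong_epi (pb2 (coim_map (pt_map x)) (kernel g)).
    by apply: regular_epi_strong; apply: sa_regular; exact: coim_map_regular_epi.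
  apply: s; first exact: im_map_mono.
  have [|t et] := @factors_kernel X _ _ _ _ _ (pt_epi A)
    (pb1 (coim_map (pt_map x)) (kernel g)).
    by rewrite -gq -compA pb_comm compA comp_kernel comp0m.
  exists (coim_map i ∘ t); rewrite compA im_coim /i -!compA et -pb_comm.
  by rewrite compA im_coim.
have [a ea] : factors n (im_map i).
  apply: (@coim_map_strong _ _ i); first exact: im_map_mono.
  by rewrite im_coim; exists (coim_map (pt_map x) ∘ kernel (pt_epi A));
    rewrite compA im_coim.
have [b eb] : factors n (im_map (pt_sec D)).
  apply: (@coim_map_strong _ _ (pt_sec D)); first exact: im_map_mono.
  by rewrite im_coim; exists (coim_map (pt_map x) ∘ pt_sec A);
    rewrite compA im_coim pt_map_sec.
have ga : g ∘ a = zero_mor _ _.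
  apply: (@strong_epi_epi _ _ _ (coim_map i)); first exact: coim_map_strong.
  rewrite comp0m /g -!compA (compA n) ea im_coim /i compA.
  by rewrite pt_map_epi comp_kernel.
rewrite /w_normal -[sub_le _ _]/(factors (im_map i) (im_map _)).
apply: (@coim_map_strong _ _ _); first exact: im_map_mono.
rewrite im_coim.
have [|t et] := @factors_kernel X _ _ _ _ _ g
  (copair b a ∘ kernel (coprod_to_prod _ _)).
  have -> : g ∘ (copair b a ∘ kernel (coprod_to_prod _ _)) =
    g ∘ b ∘ (copair (idm _) (zero_mor _ _) ∘ kernel (coprod_to_prod _ _)).
    by rewrite !compA !comp_copair ga compm0 compm1.
  by rewrite diamond_kernel1 compm0.
apply: factors_trans kI _; exists t.
by rewrite -compA et compA comp_copair ea eb.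
Qed.

Lemma SSH_kernels :
  SSH X <->
  forall (B : X) (A A' D : Pt B) (x : A ~> D) (y : A' ~> D),
    huq_commute (pt_map x ∘ kernel (pt_epi A))
      (pt_map y ∘ kernel (pt_epi A')) ->
    huq_commute x y.
Proof.
split=> H.
- by move=> B A A' D x y /kernels_huq_commute; exact: H.
- by move=> E B p A A' D x y /huq_commute_kernels; exact: H.
Qed.

(** * The equivalences *)

Definition proper_huq_commute_over : Prop :=
  forall (U V W D : X) (x : U ~> D) (y : V ~> D) (w : W ~> D),
    w_proper x y w -> huq_commute x y -> commute_over x y w.

Lemma SSH_commute_over : SSH X <-> proper_huq_commute_over.
Proof.
rewrite SSH_kernels; split=> H.
- move=> U V W D x y w [nx ny] hxy.
  have es : pr2 D W ∘ bpair w (idm W) = idm W by rewrite pr2_bpair.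
  (* the codomain D is turned into a point over W whose kernel is D *)
  pose (D' := Point es : Pt W).
  have he T (z : T ~> D) :
      pt_epi D' ∘ bpair (copair w z) (copair (idm W) (zero_mor T W))
      = pt_epi (coprod_point W T) by rewrite /= pr2_bpair.
  have hs T (z : T ~> D) :
      bpair (copair w z) (copair (idm W) (zero_mor T W))
      ∘ pt_sec (coprod_point W T) = pt_sec D'.
    by apply: bprod_uniq; cat_simpl.
  pose (h T (z : T ~> D) :=
      @PointHom _ _ (coprod_point W T) D' _ (he T z) (hs T z)
    : (coprod_point W T : Pt W) ~> D').
  have [phi [e1 e2]] : commute_on (pt_map (h _ x)) (pt_map (h _ y)).
    apply/pt_huq_commute; apply: H => /=.
    have E T (z : T ~> D) a : im_map z ∘ a =
        copair w z ∘ kernel (copair (idm W) (zero_mor T W)) ->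
      bpair (copair w z) (copair (idm W) (zero_mor T W))
        ∘ kernel (copair (idm W) (zero_mor T W))
      = bpair (idm D) (zero_mor D W) ∘ im_map z ∘ a.
      by move=> e; apply: bprod_uniq; rewrite -?compA e; cat_simpl.
    have [a ea] := factors_conjugation nx.
    have [b eb] := factors_conjugation ny.
    rewrite (E _ _ _ ea) (E _ _ _ eb); apply: huq_commute_comp.
    exact: (huq_commute_im x y).1.
  exists (pr1 D W ∘ phi); rewrite -!compA e1 e2 /=.
  by rewrite !pr1_bpair.
- move=> B A A' D x y hxy; apply/pt_huq_commute.
  have := H _ _ _ _ _ _ (pt_sec D)
    (conj (w_normal_kernel x) (w_normal_kernel y)) hxy.
  rewrite commute_overE.
  (* every point T over B is a quotient of the coproduct point B + Ker *)
  have s (T : point B) : strong_epi (copair (pt_sec T) (kernel (pt_epi T))).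
    move=> M S m v mm vq.
    have js := split_jointly_strong (pt_epi_sec T) (ex_intro _ (idm _) (compm1 _)).
    apply: (js _ _ _ _ mm).
    - by have := factors_comp (in2 _ _) vq; rewrite -compA copair_in2.
    - by have := factors_comp (in1 _ _) vq; rewrite -compA copair_in1.
  have o (T : point B) : @over_base _ _ (idm B)
      (coprod_point B (pb (pt_epi T) (from_zero B))) T
      (copair (pt_sec T) (kernel (pt_epi T))).
    split; rewrite ?comp1m ?compm1 /= ?copair_in1 //.
    by rewrite comp_copair pt_epi_sec comp_kernel.
  have E (T : point B) (z : point_hom T D) :
    copair (pt_sec D) (pt_map z ∘ kernel (pt_epi T))
    = pt_map z ∘ copair (pt_sec T) (kernel (pt_epi T)).
    by rewrite comp_copair pt_map_sec.
  rewrite !E; exact: (commute_on_desc (o _) (o _) (s _) (s _)).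
Qed.

Lemma commute_over_weight_indep :
  proper_huq_commute_over <->
  forall (U V D : X) (x : U ~> D) (y : V ~> D)
      (W : X) (w : W ~> D) (W' : X) (w' : W' ~> D),
    w_proper x y w -> w_proper x y w' ->
    (commute_over x y w <-> commute_over x y w').
Proof.
split=> H.
- move=> U V D x y W w W' w' p p'.
  by split=> /commute_over_huq; exact: H.
- move=> U V W D x y w p /huq_commute_over_zero.
  by apply: (H _ _ _ _ _ _ _ _ _ _ p).1; split; exact: w_normal_zero.
Qed.

Lemma commute_over_ternary :
  proper_huq_commute_over <->
  forall (U V W D : X) (x : U ~> D) (y : V ~> D) (w : W ~> D),
    w_proper x y w ->
    sub_eq (higgins2 (Im x) (Im y)) (sub_zero D) ->
    sub_eq (higgins3 (Im x) (Im y) (Im w)) (sub_zero D).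
Proof.
split=> H U V W D x y w p.
- move=> /huq_commute_commutator c; apply/ternary_commutator_zero => //.
  exact: H.
- move=> c; apply/(ternary_commutator_zero _ c); apply: H => //.
  exact/huq_commute_commutator.
Qed.

End SemiAbelian.

Theorem theorem3p12 (X : semi_abelian) :
  [<-> SSH X;

    forall (U V W D : X) (x : U ~> D) (y : V ~> D) (w : W ~> D),
      w_proper x y w -> huq_commute x y -> commute_over x y w;

    forall (U V D : X) (x : U ~> D) (y : V ~> D)
      (W : X) (w : W ~> D) (W' : X) (w' : W' ~> D),
      w_proper x y w -> w_proper x y w' ->
      (commute_over x y w <-> commute_over x y w');

    forall (U V W D : X) (x : U ~> D) (y : V ~> D) (w : W ~> D),
      w_proper x y w ->
      sub_eq (higgins2 (Im x) (Im y)) (sub_zero D) ->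
      sub_eq (higgins3 (Im x) (Im y) (Im w)) (sub_zero D)].
Proof.
tfae.
- exact: (SSH_commute_over (X := X)).1.
- exact: (commute_over_weight_indep (X := X)).1.
- by move/commute_over_weight_indep; exact: (commute_over_ternary (X := X)).1.
- by move/commute_over_ternary; exact: (SSH_commute_over (X := X)).2.
Qed.
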